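(* Let $\mathcal{H}_{B_1\cdots B_m}=\bigotimes_{i=1}^m\mathcal{H}_{B_i}$ ($m\ge 2$) be a tensor product of finite-dimensional Hilbert spaces, let $\mathscr{C}$ be a set of pure states in $\mathcal{H}_{B_1\cdots B_m}$ (equipped with a probability measure used for averages), let $k\le m$ be a positive integer, and let $S$ be a subsystem consisting of $k$ of the $m$ parties. Then, with the dependence on $\mathscr{C}$ and $k$ suppressed, $$\Lambda^{\mathrm M}_S\le \mathcal V^{\mathrm M}_S\le 2\Lambda^{\mathrm M}_S,\quad \Lambda^{\mathrm M}\le \mathcal V^{\mathrm M}\le 2\Lambda^{\mathrm M},\quad \mathcal V^{\mathrm M}_S\le 2\widetilde\Lambda^{\mathrm M}_S,\quad \mathcal V^{\mathrm M}\le 2\widetilde\Lambda^{\mathrm M};$$ $$\Lambda^{\mathrm A}_S\le \mathcal V^{\mathrm A}_S\le 2\Lambda^{\mathrm A}_S,\quad \Lambda^{\mathrm A}\le \mathcal V^{\mathrm A}\le 2\Lambda^{\mathrm A},\quad \mathcal V^{\mathrm A}_S\le 2\widetilde\Lambda^{\mathrm A}_S,\quad \mathcal V^{\mathrm A}\le 2\widetilde\Lambda^{\mathrm A};$$ $$\Lambda^{\mathrm A}_S\le \Lambda^{\mathrm M}_S,\quad \Lambda^{\mathrm A}\le \Lambda^{\mathrm M},\quad \mathcal V^{\mathrm A}_S\le \mathcal V^{\mathrm M}_S,\quad \mathcal V^{\mathrm A}\le \mathcal V^{\mathrm M}.$$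
   Context: For a unit vector $|\psi\rangle$, $\psi:=|\psi\rangle\langle\psi|$ and $\psi_S:=\mathrm{Tr}_{S^c}(\psi)$, where $S^c$ is the complementary subsystem. The trace distance is $D(\rho,\sigma):=\|\rho-\sigma\|_1$ (no factor $1/2$). $\Pi(\mathscr C):=\mathbb E_{|\psi\rangle\in\mathscr C}\,\psi$, $\Pi_S(\mathscr C):=\mathrm{Tr}_{S^c}\Pi(\mathscr C)$, and $\widetilde{\mathbb 1}_S:=\mathbb 1_S/d_S$ is the maximally mixed state on $S$. $\mathbb E$ is expectation with respect to the probability measure on $\mathscr C$, with $|\psi\rangle,|\psi'\rangle$ independent; maxima over $\mathscr C$ are suprema. Definitions: - $\mathcal V^{\mathrm M}_S(\mathscr C):=\max_{|\psi\rangle,|\psi'\rangle\in\mathscr C}D(\psi_S,\psi'_S)$, $\ \mathcal V^{\mathrm A}_S(\mathscr C):=\mathbb E_{|\psi\rangle,|\psi'\rangle\in\mathscr C}D(\psi_S,\psi'_S)$; - $\Lambda^{\mathrm M}_S(\mathscr C):=\max_{|\psi\rangle\in\mathscr C}D(\psi_S,\Pi_S(\mathscr C))$, $\ \Lambda^{\mathrm A}_S(\mathscr C):=\mathbb E_{|\psi\rangle\in\mathscr C}D(\psi_S,\Pi_S(\mathscr C))$; - $\widetilde\Lambda^{\mathrm M}_S(\mathscr C):=\max_{|\psi\rangle\in\mathscr C}D(\psi_S,\widetilde{\mathbb 1}_S)$, $\ \widetilde\Lambda^{\mathrm A}_S(\mathscr C):=\mathbb E_{|\psi\rangle\in\mathscr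 C}D(\psi_S,\widetilde{\mathbb 1}_S)$. Each quantity without subscript $S$, e.g. $\mathcal V^{\mathrm M}(\mathscr C,k)$, is the maximum of the corresponding quantity over all subsystems $S$ with $|S|=k$. *)

(* Defs.v *)
From HB Require Import structures.
From mathcomp Require Import all_boot all_order all_algebra.
From mathcomp Require Import sesquilinear spectral complex.
From mathcomp Require Import all_classical all_reals all_analysis.

Set Implicit Arguments.
Unset Strict Implicit.
Unset Printing Implicit Defensive.
Import Order.TTheory GRing.Theory Num.Theory.
Local Open Scope classical_set_scope.
Local Open Scope ring_scope.
Local Open Scope complex_scope.
Local Open Scope sesquilinear_scope.

Section trace_norm.
Context {R : realType} {n : nat}.
Implicit Types A B : 'M[R[i]]_n.

(* Square root of a positive semidefinite matrix A = U^-1 diag(X) U by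
   functional calculus; a junk value if A is not normal. *)
Definition psd_sqrtmx A : 'M[R[i]]_n :=
  invmx (spectralmx A) *m diag_mx (map_mx sqrtC (spectral_diag A))
    *m spectralmx A.

(* ||A||_1 = Tr sqrt(A^* A); this trace is real, Re only changes its type. *)
Definition trace_norm A : R := complex.Re (\tr (psd_sqrtmx (A^t* *m A))).

Definition trace_dist A B : R := trace_norm (A - B).

End trace_norm.

Section multipartite.
Context (R : realType) {m : nat} (d : 'I_m -> nat).

(* Party i is C^(d i). The product basis of the tensor product is indexed by
   the dependent functions x with x i < d i, and that of subsystem S by the
   restrictions of such functions to S; matrices and vectors use the
   enumerations of these finite types. *)
Definition prod_basis : finType := {dffun forall i : 'I_m, 'I_(d i)}.

Definition sub_basis (S : {set 'I_m}) : finType :=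
  {dffun forall i : {i : 'I_m | i \in S}, 'I_(d (val i))}.

Definition restr (S : {set 'I_m}) (x : prod_basis) : sub_basis S :=
  [ffun i : {i : 'I_m | i \in S} => x (val i)].

Definition ket := 'cV[R[i]]_#|prod_basis|.
Definition operator := 'M[R[i]]_#|prod_basis|.
Definition sub_operator (S : {set 'I_m}) := 'M[R[i]]_#|sub_basis S|.

Definition unit_vector (psi : ket) : Prop := psi^t* *m psi = 1%:M.

Definition projector (psi : ket) : operator := psi *m psi^t*.

(* <a| Tr_{S^c} A |b> = \sum_c <a (x) c| A |b (x) c>, where the basis vectors
   a (x) c and b (x) c are the x and y that restrict to a and b on S and to a
   common c on S^c. *)
Definition ptrace (S : {set 'I_m}) (A : operator) : sub_operator S :=
  \matrix_(a, b)
    \sum_(x | restr S (enum_val x) == enum_val a)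
    \sum_(y | (restr S (enum_val y) == enum_val b) &&
              (restr (~: S) (enum_val x) == restr (~: S) (enum_val y)))
      A x y.

Definition reduced (S : {set 'I_m}) (psi : ket) : sub_operator S :=
  ptrace S (projector psi).

Definition maximally_mixed (S : {set 'I_m}) : sub_operator S :=
  (#|sub_basis S|%:R : R[i])^-1 *: 1%:M.

Section ensemble.
Context (C : set ket).

(* The set C as a type. Nonemptiness, which any probability measure on C
   forces, is needed because measurable types are pointed. *)
Definition ensemble (C0 : C !=set0) : Type := set_type C.

Context (C0 : C !=set0).

HB.instance Definition _ := Choice.copy (ensemble C0) (set_type C).
HB.instance Definition _ := isPointed.Build (ensemble C0)
  (SigSub (mem_set (projT2 (cid C0))) : ensemble C0).

Definition ket_of (psi : ensemble C0) : ket := set_val (psi : set_type C).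

Definition amplitudes : set (set (ensemble C0)) :=
  [set A | exists j (B : set R), measurable B /\
     (A = [set psi | B (complex.Re (ket_of psi j 0))] \/
      A = [set psi | B (complex.Im (ket_of psi j 0))])].

(* C with the trace of the Borel sigma-algebra of the Hilbert space (as a real
   vector space): the one generated by the real and imaginary parts of the
   amplitudes. *)
Definition ensembleType := g_sigma_algebraType amplitudes.

Local Open Scope ereal_scope.

Definition VM (S : {set 'I_m}) : \bar R :=
  ereal_sup [set (trace_dist (reduced S psi) (reduced S psi'))%:E
            | psi in C & psi' in C].

Definition tLambdaM (S : {set 'I_m}) : \bar R :=
  ereal_sup [set (trace_dist (reduced S psi) (maximally_mixed S))%:E
            | psi in C].

Context (P : probability ensembleType R).

(* The expectation of the projectors |psi><psi|, taken entrywise on real and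
   imaginary parts; these are bounded, so fine only changes their type. *)
Definition mean_state : operator :=
  \matrix_(j, l)
    (fine 'E_P[fun psi => complex.Re (projector (ket_of psi) j l)] +i*
     fine 'E_P[fun psi => complex.Im (projector (ket_of psi) j l)])%C.

Definition LambdaM (S : {set 'I_m}) : \bar R :=
  ereal_sup [set (trace_dist (reduced S psi) (ptrace S mean_state))%:E
            | psi in C].

Definition VA (S : {set 'I_m}) : \bar R :=
  'E_(P \x P)[fun z => trace_dist (reduced S (ket_of z.1))
                                  (reduced S (ket_of z.2))].

Definition LambdaA (S : {set 'I_m}) : \bar R :=
  'E_P[fun psi => trace_dist (reduced S (ket_of psi)) (ptrace S mean_state)].

Definition tLambdaA (S : {set 'I_m}) : \bar R :=
  'E_P[fun psi => trace_dist (reduced S (ket_of psi)) (maximally_mixed S)].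

End ensemble.

Definition max_over (k : nat) (F : {set 'I_m} -> \bar R) : \bar R :=
  (\big[maxe/-oo]_(S : {set 'I_m} | #|S| == k) F S)%E.

End multipartite.

(* Main.v *)
Require Import Defs.
From HB Require Import structures.
From mathcomp Require Import all_boot all_order all_algebra.
From mathcomp Require Import sesquilinear spectral complex.
From mathcomp Require Import all_classical all_reals all_analysis.
From mathcomp Require Import measurable_realfun.
From mathcomp Require Import ring lra.

Set Implicit Arguments.
Unset Strict Implicit.
Unset Printing Implicit Defensive.
Import Order.TTheory GRing.Theory Num.Theory.
Local Open Scope classical_set_scope.
Local Open Scope ring_scope.
Local Open Scope complex_scope.
Local Open Scope sesquilinear_scope.

(* On Hermitian matrices the trace norm is dual to the unitary group:
   ||A||_1 is the maximum of Re Tr (W A) over unitary W.  This yields the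
   triangle inequality, hence D(psi_S, psi'_S) <= D(psi_S, M) + D(psi'_S, M)
   for every Hermitian M, and Jensen's inequality
   D(psi_S, Pi_S) <= E_psi' D(psi_S, psi'_S), since Re Tr (W Tr_{S^c} -) is a
   linear functional and so commutes with the average defining Pi.  Every bound
   follows by taking suprema or expectations, the latter on the product space
   by Tonelli; the trace distance is measurable because it is a Lipschitz
   function of the real and imaginary parts of the amplitude products. *)

(** * Real and imaginary parts of complex numbers *)

Section complex_parts.
Context {R : realType}.
Implicit Types z : R[i].

Lemma cReD : {morph @complex.Re R : x y / x + y}.
Proof. by case=> a b [c d]. Qed.

Lemma cReB : {morph @complex.Re R : x y / x - y}.
Proof. by case=> a b [c d]. Qed.

Lemma cImD : {morph @complex.Im R : x y / x + y}.
Proof. by case=> a b [c d]. Qed.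

Lemma cImB : {morph @complex.Im R : x y / x - y}.
Proof. by case=> a b [c d]. Qed.

Lemma cRe_sum I (r : seq I) (p : pred I) (F : I -> R[i]) :
  complex.Re (\sum_(i <- r | p i) F i) = \sum_(i <- r | p i) complex.Re (F i).
Proof. exact: (big_morph _ cReD). Qed.

Lemma cIm_sum I (r : seq I) (p : pred I) (F : I -> R[i]) :
  complex.Im (\sum_(i <- r | p i) F i) = \sum_(i <- r | p i) complex.Im (F i).
Proof. exact: (big_morph _ cImD). Qed.

Lemma cReM z z' : complex.Re (z * z') =
  complex.Re z * complex.Re z' - complex.Im z * complex.Im z'.
Proof. by case: z z' => a b [c d]. Qed.

Lemma cImM z z' : complex.Im (z * z') =
  complex.Re z * complex.Im z' + complex.Im z * complex.Re z'.
Proof. by case: z z' => a b [c d]. Qed.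

Lemma cRe_conj z : complex.Re (Num.conj z) = complex.Re z.
Proof. by case: z. Qed.

Lemma cIm_conj z : complex.Im (Num.conj z) = - complex.Im z.
Proof. by case: z. Qed.

Lemma conj_realC (x : R) : Num.conj x%:C = x%:C.
Proof. exact: conjc_real. Qed.

Lemma norm_Re_le z : `|complex.Re z| <= complex.Re `|z|.
Proof. by have := normc_ge_Re z; rewrite lecE => /andP[]. Qed.

Lemma norm_Im_le z : `|complex.Im z| <= complex.Re `|z|.
Proof.
rewrite normc_def /= -[X in X <= _]sqrtr_sqr ler_wsqrtr// lerDr sqr_ge0 //.
Qed.

Lemma complex_norm_le z c : `|z| <= c%:C ->
  (`|complex.Re z| <= c) /\ (`|complex.Im z| <= c).
Proof.
rewrite lecE /= => /andP[_ zc].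
by split; [apply: le_trans (norm_Re_le z) zc|apply: le_trans (norm_Im_le z) zc].
Qed.

End complex_parts.

(** * The trace norm of Hermitian matrices and its duality with unitaries *)

Section hermitian_trace_norm.
Context {R : realType} {n : nat}.
Local Notation C := R[i].
Implicit Types A B W U : 'M[C]_n.

Lemma adjmxD m p (A B : 'M[C]_(m, p)) : (A + B)^t* = A^t* + B^t*.
Proof. by apply/matrixP => i j; rewrite !mxE rmorphD. Qed.

Lemma adjmxB m p (A B : 'M[C]_(m, p)) : (A - B)^t* = A^t* - B^t*.
Proof. by apply/matrixP => i j; rewrite !mxE rmorphB. Qed.

Lemma adjmxM m p q (A : 'M[C]_(m, p)) (B : 'M[C]_(p, q)) :
  (A *m B)^t* = B^t* *m A^t*.
Proof. by rewrite trmx_mul map_mxM. Qed.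

Lemma adjmx_diag_real (l : 'I_n -> R) :
  (diag_mx (\row_i (l i)%:C) : 'M[C]_n)^t* = diag_mx (\row_i (l i)%:C).
Proof.
apply/matrixP => i j; rewrite !mxE rmorphMn /= eq_sym.
by case: eqP => [->|]; rewrite ?mulr0n// conj_realC.
Qed.

Lemma unitarymxV W : W \is unitarymx -> W^t* *m W = 1%:M.
Proof. by move/unitarymxP/mulmx1C. Qed.

Lemma adjmx_unitary W : W \is unitarymx -> W^t* \is unitarymx.
Proof. by move=> Wu; apply/unitarymxP; rewrite trmxCK unitarymxV. Qed.

Lemma unitary_entry_le W i j : W \is unitarymx -> `|W i j| <= 1.
Proof.
move=> /unitarymxP/matrixP/(_ i i); rewrite !mxE eqxx /= => sumW.
have : `|W i j| ^+ 2 <= 1.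
  rewrite -[X in _ <= X]/(1%:R) -sumW (bigD1 j)//= !mxE -normCK lerDl sumr_ge0// => k _.
  by rewrite !mxE -normCK exprn_ge0.
by rewrite expr_le1.
Qed.

(** Identifies the spectrum in any unitary diagonalization up to order, so that an arbitrary
    diagonalization can be compared with the one chosen by [spectralmx]. *)
Lemma char_poly_unitary U (s : 'rV[C]_n) : U \is unitarymx ->
  char_poly (U^t* *m diag_mx s *m U) = \prod_(i < n) ('X - (s 0 i)%:P).
Proof.
move=> /unitarymxV UU.
have diag_trig : is_trig_mx (diag_mx s) by exact/is_diag_mx_is_trig/diag_mx_is_diag.
transitivity (char_poly (diag_mx s)); last first.
  by rewrite char_poly_trig//; apply: eq_bigr => i _; rewrite mxE eqxx.
have PUU : map_mx (@polyC _) (U^t*) *m map_mx (@polyC _) U = 1%:M.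
  by rewrite -map_mxM UU map_mx1.
rewrite /char_poly /char_poly_mx !map_mxM.
(* Scalar matrices commute with everything, so conjugation by [U] fixes ['X%:M] and can be factored
   out of the whole characteristic matrix. *)
have eqX : 'X%:M = map_mx (@polyC _) (U^t*) *m 'X%:M *m map_mx (@polyC _) U.
  by rewrite -mulmxA -scalar_mxC mulmxA PUU mul1mx.
rewrite [in LHS]eqX -mulmxBl -mulmxBr !det_mulmx mulrC mulrA -det_mulmx.
by rewrite (mulmx1C PUU) det1 mul1r.
Qed.

Lemma unitary_conjM U A B : U \is unitarymx ->
  (U^t* *m A *m U) *m (U^t* *m B *m U) = U^t* *m (A *m B) *m U.
Proof. by move=> Uu; rewrite !mulmxA mulmxtVK. Qed.

(** The square of the matrix has eigenvalues [l i ^+ 2]. Its chosen spectral decomposition must list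
    the same values in some order, and their square roots are the [|l i|]. *)
Lemma trace_norm_unitary_diag U (l : 'I_n -> R) : U \is unitarymx ->
  trace_norm (U^t* *m diag_mx (\row_i (l i)%:C) *m U) = \sum_i `|l i|.
Proof.
move=> Uu; pose L : 'M[C]_n := diag_mx (\row_i (l i)%:C).
have LL : L *m L = diag_mx (\row_i ((l i) ^+ 2)%:C).
  rewrite mulmx_diag; congr diag_mx.
  by apply/rowP => i; rewrite !mxE -rmorphM.
rewrite -/L /trace_norm; have : (U^t* *m L *m U)^t* = U^t* *m L *m U.
  by rewrite !adjmxM trmxCK adjmx_diag_real mulmxA.
have := unitary_conjM L L Uu; rewrite LL.
move: (U^t* *m L *m U) => A AA Ah.
have AAh : A *m A \is hermsymmx.
  by apply/is_hermitianmxP; rewrite expr0 scale1r adjmxM Ah.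
rewrite {}Ah; move: (A *m A) AAh AA => B Bh eqB.
have /orthomx_spectralP := hermitian_normalmx Bh.
have Pu := spectral_unitarymx B.
(* By cyclicity of the trace only the sum of the square roots of the spectral diagonal remains. *)
rewrite /psd_sqrtmx mxtrace_mulC mulmxA mulmxV ?unitarymx_unit// mul1mx.
rewrite mxtrace_diag.
rewrite invmx_unitary// {1}eqB => eqP.
have /(congr1 char_poly) := eqP.
rewrite !char_poly_unitary//.
set sp := spectral_diag _.
move=> eq_prod.
(* Equal products of monic linear factors have the same roots up to a permutation. *)
have /prod_XsubC_eq : \prod_(x <- [seq ((l i) ^+ 2)%:C | i : 'I_n]) ('X - x%:P)
         = \prod_(x <- [seq sp 0 i | i : 'I_n]) ('X - x%:P).
  by rewrite !big_image -eq_prod; apply: eq_bigr => i _; rewrite mxE.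
move=> perm.
transitivity (complex.Re (\sum_(x <- [seq sp 0 i | i : 'I_n]) sqrtC x)).
  by rewrite big_image; congr complex.Re; apply: eq_bigr => i _; rewrite mxE.
rewrite -(perm_big _ perm) /= big_image cRe_sum; apply: eq_bigr => i _.
by rewrite -[l i ^+ 2]real_normK ?num_real// rmorphXn /= sqrCK ?ler0c.
Qed.

Lemma hermitian_diagonalization A : A^t* = A ->
  exists2 U : 'M[C]_n, U \is unitarymx &
    exists l : 'I_n -> R, A = U^t* *m diag_mx (\row_i (l i)%:C) *m U.
Proof.
move=> Ah; have hA : A \is hermsymmx.
  by apply/is_hermitianmxP; rewrite expr0 scale1r.
have Uu := spectral_unitarymx A.
exists (spectralmx A) => //; exists (fun i => complex.Re (spectral_diag A 0 i)).
have -> : \row_i (complex.Re (spectral_diag A 0 i))%:C = spectral_diag A.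
  apply/rowP => i; rewrite mxE.
  have /mxOverP/(_ 0 i) := hermitian_spectral_diag_real hA.
  by case: (spectral_diag A 0 i) => a b; rewrite complex_real /= => /eqP ->.
rewrite -(invmx_unitary Uu).
exact/orthomx_spectralP/hermitian_normalmx.
Qed.

(** In an eigenbasis of [A] the trace is the sum of the [V i i * l i] with [V] unitary, and the
    diagonal entries of [V] have modulus at most 1. *)
Lemma Re_tr_unitary_le W A : A^t* = A -> W \is unitarymx ->
  complex.Re (\tr (W *m A)) <= trace_norm A.
Proof.
move=> /hermitian_diagonalization[U Uu [l ->]] Wu.
rewrite trace_norm_unitary_diag// !mulmxA mxtrace_mulC !mulmxA.
have Vu := mul_unitarymx (mul_unitarymx Uu Wu) (adjmx_unitary Uu).
move: (U *m W *m U^t*) Vu => V Vu.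
rewrite mul_mx_diag cRe_sum; apply: ler_sum => i _; rewrite !mxE cReM /= mulr0 subr0.
apply: le_trans (ler_norm _) _; rewrite normrM ler_piMl//.
by have [] := @complex_norm_le _ (V i i) 1 (unitary_entry_le i i Vu).
Qed.

Lemma Re_tr_unitary_attained A : A^t* = A ->
  exists2 W : 'M[C]_n, W \is unitarymx & trace_norm A = complex.Re (\tr (W *m A)).
Proof.
move=> /hermitian_diagonalization[U Uu [l ->]].
(* The optimal unitary is the sign of [A]. The sign of a zero eigenvalue is set to 1, since the
   value 0 would spoil unitarity. *)
pose e i : R := if 0 <= l i then 1 else -1.
pose E : 'M[C]_n := diag_mx (\row_i (e i)%:C).
have ee i : e i * e i = 1 by rewrite /e; case: ifP => _; rewrite ?mulrNN mulr1.
exists (U^t* *m E *m U).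
  apply: (mul_unitarymx (mul_unitarymx (adjmx_unitary Uu) _) Uu).
  apply/unitarymxP.
  rewrite adjmx_diag_real mulmx_diag -diag_const_mx; congr diag_mx.
  by apply/rowP => i; rewrite !mxE -rmorphM ee.
rewrite trace_norm_unitary_diag// !mulmxA mulmxtVK// mxtrace_mulC !mulmxA.
rewrite (unitarymxP Uu) mul1mx mulmx_diag mxtrace_diag cRe_sum.
apply: eq_bigr => i _; rewrite !mxE -rmorphM /= /e.
by case: ifPn => [/ger0_norm ->|]; rewrite ?mul1r// -ltNge mulN1r => /ltr0_norm.
Qed.

Lemma trace_norm_ge0 A : A^t* = A -> 0 <= trace_norm A.
Proof.
move=> /hermitian_diagonalization[U Uu [l ->]].
by rewrite trace_norm_unitary_diag// sumr_ge0.
Qed.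

(** A unitary attaining the norm of the sum is a competitor for both summands. *)
Lemma ler_trace_normD A B : A^t* = A -> B^t* = B ->
  trace_norm (A + B) <= trace_norm A + trace_norm B.
Proof.
move=> Ah Bh.
have /Re_tr_unitary_attained[W Wu ->] : (A + B)^t* = A + B by rewrite adjmxD Ah Bh.
by rewrite mulmxDr mxtraceD cReD lerD// Re_tr_unitary_le.
Qed.

Lemma trace_normN A : A^t* = A -> trace_norm (- A) = trace_norm A.
Proof.
move=> /hermitian_diagonalization[U Uu [l ->]].
have -> : - (U^t* *m diag_mx (\row_i (l i)%:C) *m U) =
    U^t* *m diag_mx (\row_i (- l i)%:C) *m U.
  rewrite -mulNmx -mulmxN; congr (_ *m _ *m _).
  by apply/matrixP => i j; rewrite !mxE rmorphN mulNrn.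
by rewrite !(trace_norm_unitary_diag _ Uu); apply: eq_bigr => i _; rewrite normrN.
Qed.

(** A crude bound, by the moduli of the entries of the optimal unitary being at most 1. It serves to
    show that the trace norm is Lipschitz in the entries. *)
Lemma trace_norm_le_entries A : A^t* = A ->
  trace_norm A <= \sum_i \sum_j (`|complex.Re (A i j)| + `|complex.Im (A i j)|).
Proof.
move=> /Re_tr_unitary_attained[W Wu ->].
rewrite mxtrace_mulC cRe_sum; apply: ler_sum => i _.
rewrite mxE cRe_sum; apply: ler_sum => j _.
have [Wr Wi] := @complex_norm_le _ (W j i) 1 (unitary_entry_le j i Wu).
rewrite cReM; apply: le_trans (ler_norm _) _; apply: le_trans (ler_normB _ _) _.
by rewrite !normrM lerD// ler_piMr.
Qed.

Lemma trace_distC A B : A^t* = A -> B^t* = B -> trace_dist A B = trace_dist B A.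
Proof.
by move=> Ah Bh; rewrite /trace_dist -opprB trace_normN// adjmxB Ah Bh.
Qed.

Lemma trace_dist_triangle A B M : A^t* = A -> B^t* = B -> M^t* = M ->
  trace_dist A B <= trace_dist A M + trace_dist B M.
Proof.
move=> Ah Bh Mh; rewrite [trace_dist B M]trace_distC// /trace_dist.
by rewrite -[A - B](subrKA M) ler_trace_normD// adjmxB ?Ah ?Bh ?Mh.
Qed.

End hermitian_trace_norm.

(* [F x] is the infimum of [F q + \sum_j `|x j - q j|] over rational [q], so
   that its strict sublevel sets are countable unions of measurable sets. *)
Lemma measurable_lipschitz_comp d (T : measurableType d) (R : realType)
    (J : finType) (F : (J -> R) -> R) (g : J -> T -> R) :
  (forall x y, `|F x - F y| <= \sum_j `|x j - y j|) ->
  (forall j, measurable_fun setT (g j)) ->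
  measurable_fun setT (fun t => F (g ^~ t)).
Proof.
move=> Flip mg; apply: (measurability _ (RGenInftyO.measurableE R)).
move=> _ [_ [c ->] <-]; rewrite setTI.
pose h (q : {ffun J -> rat}) t :=
  F (fun j => ratr (q j)) + \sum_j `|g j t - ratr (q j)|.
have -> : (fun t => F (g ^~ t)) @^-1` `]-oo, c[ =
    \bigcup_q (h q @^-1` `]-oo, c[).
  apply/seteqP; split => t /=; rewrite in_itv /=.
    (* The gap [c - F (g ^~ t)] is split into [2 * #|J| + 2] pieces of size [e]: moving to [q] costs
       at most [#|J| * e] in [F] and as much in the added sum. The two spare pieces make the
       inequality strict, also for empty [J]. *)
    move=> Fc; pose e := (c - F (g ^~ t)) / (#|J|.*2.+2%:R).
    have e0 : 0 < e by rewrite divr_gt0// subr_gt0.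
    have near j : exists q : rat, `|g j t - ratr q| < e.
      have /rat_in_itvoo[q] : g j t - e < g j t + e by rewrite ltrD2l; lra.
      rewrite in_itv /= => /andP[q1 q2]; exists q.
      by rewrite ltr_norml; apply/andP; split; lra.
    pose q := [ffun j => projT1 (cid (near j))].
    exists q => //; rewrite /h /= in_itv /=.
    have sume : \sum_j `|g j t - ratr (q j)| <= #|J|%:R * e.
      rewrite mulr_natl -sumr_const; apply: ler_sum => j _.
      by rewrite ffunE; case: cid => p /= /ltW.
    have /ler_normlP[Fl _] := Flip (g ^~ t) (fun j => ratr (q j)).
    have ce : c - F (g ^~ t) = #|J|.*2.+2%:R * e by rewrite mulrC divfK.
    have : #|J|.*2.+2%:R * e = #|J|%:R * e + #|J|%:R * e + 2 * e.
      by rewrite -addn2 -addnn !natrD; ring.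
    by move: Fl; lra.
  move=> [q _]; rewrite /h /= in_itv /=; apply: le_lt_trans.
  have /ler_normlP[_] := Flip (g ^~ t) (fun j => ratr (q j)).
  by rewrite lerBlDl.
apply: countable_bigcupT_measurable => [|q]; first exact: countableP.
rewrite -[X in measurable X]setTI.
suff mh : measurable_fun setT (h q) by apply: mh.
apply: measurable_funD => //; apply: measurable_sum => j.
by apply: measurableT_comp => //; apply: measurable_funB.
Qed.

(** * Measurability of the trace norm of a Hermitian matrix depending on a parameter *)

Section trace_norm_measurable.
Context {R : realType} {n : nat}.
Local Notation C := R[i].
Local Notation J := (bool * ('I_n * 'I_n))%type.

(* Symmetrizing makes the trace norm of [herm_of x] Lipschitz in unconstrained
   [x], where the duality for Hermitian matrices still applies. *)
Let herm_of (x : J -> R) : 'M[C]_n := \matrix_(i, j)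
  (((x (false, (i, j)) + x (false, (j, i))) / 2) +i*
   ((x (true, (i, j)) - x (true, (j, i))) / 2)).

Let herm_ofP x : (herm_of x)^t* = herm_of x.
Proof.
apply/matrixP => i j; rewrite !mxE; apply/eqP; rewrite eq_complex /=.
by rewrite addrC eqxx /= -mulNr opprB.
Qed.

Let herm_ofB x y : herm_of x - herm_of y = herm_of (fun k => x k - y k).
Proof.
apply/matrixP => i j; rewrite !mxE; apply/eqP; rewrite eq_complex /=.
by apply/andP; split; apply/eqP; lra.
Qed.

(** Since [herm_of] respects differences, the triangle inequality reduces the claim to bounding the
    norm of a single [herm_of u]. *)
Let herm_of_lipschitz x y :
  `|trace_norm (herm_of x) - trace_norm (herm_of y)| <= \sum_k `|x k - y k|.
Proof.
have le_sum u : trace_norm (herm_of u) <= \sum_k `|u k|.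
  apply: le_trans (trace_norm_le_entries (herm_ofP u)) _.
  have -> : \sum_k `|u k| =
      \sum_i \sum_j (`|u (false, (i, j))| + `|u (true, (i, j))|).
    rewrite (eq_bigr (fun k : J => `|u (k.1, k.2)|)); last by case.
    rewrite -(pair_bigA _ (fun b ij => `|u (b, ij)|)) big_bool /= addrC.
    by rewrite -big_split /= pair_bigA; apply: eq_bigr => -[i j].
  pose e b i j : R := `|u (b, (i, j))|.
  rewrite -/(e false _ _) -/(e true _ _).
  (* A symmetrized entry costs half of the moduli at [(i, j)] plus half of those at [(j, i)];
     exchanging the indices in the second half restores the full sum. *)
  apply: (@le_trans _ _
    (\sum_i \sum_j ((e false i j + e true i j) / 2 + (e false j i + e true j i) / 2))).
    apply: ler_sum => i _; apply: ler_sum => j _; rewrite !mxE /=.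
    rewrite !normrM [ `|2^-1|]gtr0_norm ?invr_gt0//.
    have := ler_normD (u (false, (i, j))) (u (false, (j, i))).
    have := ler_normB (u (true, (i, j))) (u (true, (j, i))).
    by rewrite /e; lra.
  under eq_bigr do rewrite big_split /=.
  rewrite big_split /= [X in _ + X]exchange_big /= -big_split /=.
  rewrite le_eqVlt; apply/orP; left; apply/eqP; apply: eq_bigr => i _.
  by rewrite -big_split /=; apply: eq_bigr => j _; rewrite /e; lra.
have tri u v : trace_norm (herm_of u) - trace_norm (herm_of v) <= \sum_k `|u k - v k|.
  rewrite lerBlDl -[X in trace_norm X](subrK (herm_of v)) addrC herm_ofB.
  apply: le_trans (ler_trace_normD (herm_ofP _) (herm_ofP _)) _.
  by rewrite lerD2l.
rewrite ler_norml tri andbT lerNl opprB.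
by under eq_bigr do rewrite distrC.
Qed.

Lemma measurable_trace_norm d (T : measurableType d) (A : T -> 'M[C]_n) :
  (forall t, (A t)^t* = A t) ->
  (forall i j, measurable_fun setT (fun t => complex.Re (A t i j))) ->
  (forall i j, measurable_fun setT (fun t => complex.Im (A t i j))) ->
  measurable_fun setT (fun t => trace_norm (A t)).
Proof.
move=> Ah mRe mIm.
pose g (k : J) t := if k.1 then complex.Im (A t k.2.1 k.2.2)
                    else complex.Re (A t k.2.1 k.2.2).
(* A Hermitian matrix equals its own symmetrization. *)
have -> : (fun t => trace_norm (A t)) = (fun t => trace_norm (herm_of (g ^~ t))).
  apply/funext => t; congr trace_norm; rewrite -[LHS](Ah t).
  apply/matrixP => i j; rewrite !mxE /g /=.
  have /matrixP/(_ i j) := Ah t; rewrite !mxE.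
  move: (A t i j) (A t j i) => [a b] [c e] [<- <-].
  by apply/eqP; rewrite eq_complex /=; apply/andP; split; apply/eqP; lra.
apply: (measurable_lipschitz_comp herm_of_lipschitz) => -[[] [i j]];
  [exact: mIm|exact: mRe].
Qed.

End trace_norm_measurable.

(** * Expectations over one point and over two independent points *)

Section pairwise_and_central_averages.
Local Open Scope ereal_scope.
Context d (T : measurableType d) (R : realType) (P : probability T R).

Lemma expectationE (X : T -> R) : 'E_P[X] = \int[P]_x (X x)%:E.
Proof. by rewrite unlock. Qed.

(** The bound [c] is an extended real so that a supremum can be inserted directly. *)
Lemma expectation_le_cst (f : T -> R) (c : \bar R) :
  measurable_fun setT f -> (forall x, (0 <= f x)%R) ->
  (forall x, (f x)%:E <= c) -> 'E_P[f] <= c.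
Proof.
move=> mf f0 fc; rewrite unlock -[leRHS]mule1 -(@probability_setT _ _ _ P).
rewrite -integral_cst//; apply: ge0_le_integral => //.
- by move=> x _; rewrite lee_fin.
- exact/measurable_EFinP.
Qed.

(** Meant for a signed [f], such as the real part of a trace, below a nonnegative [g]. Either the
    expectation of [g] is infinite, or [g] is integrable and monotonicity applies. *)
Lemma expectation_le_of_le_integral (f g : T -> R) :
  measurable_fun setT g -> (forall x, (0 <= g x)%R) ->
  P.-integrable setT (EFin \o f) -> (forall x, (f x <= g x)%R) ->
  'E_P[f] <= 'E_P[g].
Proof.
move=> mg g0 intf fg; rewrite unlock.
have [->|goo] := eqVneq (\int[P]_x (g x)%:E) +oo; first exact: leey.
apply: le_integral => //; last by move=> x _; rewrite lee_fin.
apply/integrableP; split; first exact/measurable_EFinP.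
under eq_integral do rewrite gee0_abs ?lee_fin//.
by rewrite ltey.
Qed.

Context (D : T * T -> R) (mD : measurable_fun setT D) (D0 : forall z, (0 <= D z)%R).
Context (e : T -> R) (me : measurable_fun setT e) (e0 : forall x, (0 <= e x)%R).

Let mEe : measurable_fun setT (EFin \o e).
Proof. exact/measurable_EFinP. Qed.

Let mED : measurable_fun setT (EFin \o D).
Proof. exact/measurable_EFinP. Qed.

Let D_tonelli : 'E_(P \x P)[D] = \int[P]_x \int[P]_y (D (x, y))%:E.
Proof. by rewrite unlock (fubini_tonelli1 (EFin \o D)). Qed.

Let mDx : measurable_fun setT (fun x => \int[P]_y (D (x, y))%:E).
Proof. exact: (measurable_fun_fubini_tonelli_F (m2 := P) (EFin \o D)). Qed.

(** Here [D] stands for the distance between two points and [e] for the distance to a centre.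
    Integrating over [y] and then over [x] turns each summand of the bound into the expectation of
    [e]. *)
Lemma expectation_pair_le_central :
  (forall x y, (D (x, y) <= e x + e y)%R) -> 'E_(P \x P)[D] <= 2%:E * 'E_P[e].
Proof.
move=> De; rewrite D_tonelli unlock.
have e_ge0 : 0 <= \int[P]_x (e x)%:E.
  by apply: integral_ge0 => x _; rewrite lee_fin.
have mecst c : measurable_fun setT (fun=> c : \bar R) := @measurable_cst _ _ T _ setT c.
have leD x : \int[P]_y (D (x, y))%:E <= (e x)%:E + \int[P]_y (e y)%:E.
  (* As [P] has total mass 1, the constant [e x] is its own integral over [y], and the right side
     becomes a single integral. *)
  rewrite -[X in X + _]mule1 -[X in _ * X](@probability_setT _ _ _ P).
  rewrite -integral_cst// -ge0_integralD//; first last.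
  - by move=> y _; rewrite lee_fin.
  - by move=> y _; rewrite lee_fin.
  apply: ge0_le_integral => //.
  - by move=> y _; rewrite lee_fin.
  - by apply/measurable_EFinP; apply: measurableT_comp => //; exact: measurable_pair1.
  - by apply: emeasurable_funD => //; exact: measurable_cst.
  - by move=> y _; rewrite -EFinD lee_fin.
apply: (@le_trans _ _ (\int[P]_x ((e x)%:E + cst (\int[P]_y (e y)%:E) x))).
  apply: ge0_le_integral => //; last exact: emeasurable_funD.
  by move=> x _; apply: integral_ge0 => y _; rewrite lee_fin.
rewrite ge0_integralD//; last by move=> x _; rewrite lee_fin.
rewrite integral_cst// [X in _ + _ * X](@probability_setT _ _ _ P).
by rewrite mule1 mule_natl mule2n.
Qed.

Lemma expectation_central_le_pair :
  (forall x, (e x)%:E <= 'E_P[fun y => D (x, y)]) -> 'E_P[e] <= 'E_(P \x P)[D].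
Proof.
move=> eD; rewrite D_tonelli unlock; apply: ge0_le_integral => //.
  by move=> x _; rewrite lee_fin.
by move=> x _; have := eD x; rewrite unlock.
Qed.

End pairwise_and_central_averages.

(** * Linearity and Hermitian symmetry of the partial trace *)

Section partial_trace.
Context {R : realType} {m : nat} {d : 'I_m -> nat}.
Local Notation C := R[i].
Implicit Types (S : {set 'I_m}) (A B : operator R d).

(** With the conditions moved into the summand, the index sets no longer depend on [a] and [b]:
    linearity is checked term by term, and the two sums can be exchanged for the adjoint. *)
Lemma ptraceE S A a b : ptrace S A a b =
  \sum_x \sum_y (if [&& restr S (enum_val x) == enum_val a,
      restr S (enum_val y) == enum_val b &
      restr (~: S) (enum_val x) == restr (~: S) (enum_val y)] then A x y else 0).
Proof.
rewrite mxE big_mkcond; apply: eq_bigr => x _.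
by case: ifP => _ /=; [rewrite big_mkcond|rewrite big1].
Qed.

Lemma ptraceD S : {morph @ptrace R m d S : A B / A + B}.
Proof.
move=> A B; apply/matrixP => a b; rewrite [RHS]mxE !ptraceE -big_split.
apply: eq_bigr => x _; rewrite -big_split; apply: eq_bigr => y _ /=.
by case: ifP => _; rewrite ?mxE ?addr0.
Qed.

Lemma ptraceZ S c A : ptrace S (c *: A) = c *: ptrace S A.
Proof.
apply/matrixP => a b; rewrite [RHS]mxE !ptraceE mulr_sumr.
apply: eq_bigr => x _; rewrite mulr_sumr; apply: eq_bigr => y _.
by case: ifP => _; rewrite ?mxE ?mulr0.
Qed.

Lemma ptrace_hermitian S A : A^t* = A -> (ptrace S A)^t* = ptrace S A.
Proof.
move=> Ah; apply/matrixP => a b; rewrite [LHS]mxE [X in Num.conj X]mxE !ptraceE.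
rewrite rmorph_sum; under eq_bigr do rewrite rmorph_sum.
rewrite exchange_big; apply: eq_bigr => x _; apply: eq_bigr => y _ /=.
rewrite andbCA [restr (~: S) _ == _]eq_sym.
have /matrixP/(_ x y) := Ah; rewrite !mxE => <-.
by case: ifP => _ //; rewrite rmorph0.
Qed.

Lemma projector_hermitian (psi : ket R d) : (projector psi)^t* = projector psi.
Proof. by rewrite adjmxM trmxCK. Qed.

Lemma reduced_hermitian S (psi : ket R d) : (reduced S psi)^t* = reduced S psi.
Proof. exact/ptrace_hermitian/projector_hermitian. Qed.

Lemma maximally_mixed_hermitian S :
  (maximally_mixed R d S)^t* = maximally_mixed R d S.
Proof.
apply/matrixP => a b; rewrite !mxE rmorphM fmorphV !rmorph_nat eq_sym.
by [].
Qed.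

Lemma unit_vector_entry_le (psi : ket R d) j : unit_vector psi -> `|psi j 0| <= 1.
Proof.
move=> /matrixP/(_ 0 0); rewrite !mxE eqxx => sum1.
have : `|psi j 0| ^+ 2 <= 1.
  rewrite -[X in _ <= X]/(1%:R) -sum1 (bigD1 j)//= !mxE mulrC -normCK lerDl.
  rewrite sumr_ge0// => k _.
  by rewrite !mxE mulrC -normCK exprn_ge0.
by rewrite expr_le1.
Qed.

End partial_trace.

(** Expresses a linear functional through matrix units, so that it can be compared with an
    expectation taken entrywise. *)
Lemma additive_scalar_entries (R : realType) n (f : 'M[R[i]]_n -> R[i]) :
  {morph f : A B / A + B} -> (forall c A, f (c *: A) = c * f A) ->
  forall A, f A = \sum_j \sum_l A j l * f (delta_mx j l).
Proof.
move=> fD fZ A; have f0 : f 0 = 0 by rewrite -(scale0r 0) fZ mul0r.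
rewrite [in LHS](matrix_sum_delta A) (big_morph f fD f0); apply: eq_bigr => j _.
by rewrite (big_morph f fD f0); apply: eq_bigr => l _; rewrite fZ.
Qed.

(** A boolean selects the part, so one statement covers both and the real coordinates of a matrix
    form a single finite index type. *)
Definition cpart (R : realType) (b : bool) (z : R[i]) : R :=
  if b then complex.Im z else complex.Re z.

Lemma cpartB (R : realType) b m n (A B : 'M[R[i]]_(m, n)) i j :
  cpart b ((A - B) i j) = cpart b (A i j) - cpart b (B i j).
Proof. by case: b; rewrite /cpart !mxE ?cReB ?cImB. Qed.

(** * The mean state, and Jensen's inequality for the distance to it *)

Section mean_state.
Context (R : realType) (m : nat) (d : 'I_m -> nat) (C : set (ket R d)).
Context (C_pure : forall psi, C psi -> unit_vector psi).
Context (C0 : C !=set0) (P : probability (ensembleType C0) R).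
Local Notation T := (ensembleType C0).
Local Notation n := #|prod_basis d|.
Local Notation kof := (@ket_of R m d C C0).
Local Notation J := (bool * ('I_n * 'I_n))%type.

Lemma ket_ofP (psi : T) : C (kof psi).
Proof. exact: set_valP. Qed.

Lemma measurable_amplitude b j :
  measurable_fun setT (fun psi : T => cpart b (kof psi j 0)).
Proof.
move=> _ B mB; rewrite setTI; apply: sub_sigma_algebra.
by exists j, B; split => //; case: b; [right|left].
Qed.

Lemma measurable_projector b j l :
  measurable_fun setT (fun psi : T => cpart b (projector (kof psi) j l)).
Proof.
have mRe k := measurable_amplitude false k.
have mIm k := measurable_amplitude true k.
rewrite /cpart in mRe mIm.
case: b; rewrite /cpart.
- rewrite (_ : (fun _ => _) = (fun psi : T =>
    complex.Re (kof psi j 0) * - complex.Im (kof psi l 0) +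
    complex.Im (kof psi j 0) * complex.Re (kof psi l 0))).
    by apply: measurable_funD; apply: measurable_funM => //; apply: measurableT_comp.
  by apply/funext => psi; rewrite mxE big_ord1 !mxE cImM cRe_conj cIm_conj.
- rewrite (_ : (fun _ => _) = (fun psi : T =>
    complex.Re (kof psi j 0) * complex.Re (kof psi l 0) -
    complex.Im (kof psi j 0) * - complex.Im (kof psi l 0))).
    by apply: measurable_funB; apply: measurable_funM => //; apply: measurableT_comp.
  by apply/funext => psi; rewrite mxE big_ord1 !mxE cReM cRe_conj cIm_conj.
Qed.

(** Normalization of the kets enters here; the bound makes the entries integrable. *)
Lemma projector_entry_le (psi : T) b j l :
  `|cpart b (projector (kof psi) j l)| <= 1.
Proof.
have /complex_norm_le[? ?] : `|projector (kof psi) j l| <= 1%:C.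
  rewrite mxE big_ord1 !mxE normrM norm_conjC mulr_ile1//;
    exact/unit_vector_entry_le/C_pure/ket_ofP.
by case: b.
Qed.

Lemma integrable_projector b j l :
  P.-integrable setT (EFin \o (fun psi : T => cpart b (projector (kof psi) j l))).
Proof.
apply: measurable_bounded_integrable => //.
- exact: fin_num_fun_lty.
- exact: measurable_projector.
exists 1; split; first exact: num_real.
by move=> M M1 psi _; apply: le_trans (projector_entry_le _ _ _ _) (ltW M1).
Qed.

Lemma cpart_mean_state b j l : cpart b (mean_state P j l) =
  fine 'E_P[fun psi => cpart b (projector (kof psi) j l)].
Proof. by case: b; rewrite /cpart mxE. Qed.

(** Exchanging the indices of a projector keeps real parts and negates imaginary parts. These signs
    pass through the expectations, which are finite, so [fine] respects the product. *)
Lemma mean_state_hermitian : (mean_state P)^t* = mean_state P.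
Proof.
apply/matrixP => j l; rewrite [LHS]mxE [X in Num.conj X]mxE.
have projJ psi b : cpart b (projector (kof psi) l j) =
    (if b then -1 else 1) * cpart b (projector (kof psi) j l).
  have /matrixP/(_ l j) := projector_hermitian (kof psi).
  by rewrite !mxE => <-; case: b; rewrite /cpart ?cRe_conj ?cIm_conj ?mulN1r ?mul1r.
have meanJ b : cpart b (mean_state P l j) =
    (if b then -1 else 1) * cpart b (mean_state P j l).
  rewrite !cpart_mean_state unlock; under eq_integral do rewrite projJ EFinM.
  rewrite integralZl ?fineM//; last exact: integrable_projector.
  exact/integrable_fin_num/integrable_projector.
apply/eqP; rewrite eq_complex cRe_conj cIm_conj.
have := meanJ true; have := meanJ false; rewrite /cpart => -> ->.
by rewrite mul1r mulN1r opprK !eqxx.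
Qed.

Section functional.
Context (f : operator R d -> R[i]).
Context (fD : {morph f : A B / A + B}) (fZ : forall c A, f (c *: A) = c * f A).

(** Coefficients of the real part of [f] in the real coordinates of a matrix; the minus sign comes
    from the real part of a complex product. *)
Let w (k : J) : R :=
  let z := f (delta_mx k.2.1 k.2.2) in
  if k.1 then - complex.Im z else complex.Re z.

Let Re_functionalE A : complex.Re (f A) = \sum_(k : J) w k * cpart k.1 (A k.2.1 k.2.2).
Proof.
rewrite (additive_scalar_entries fD fZ) cRe_sum.
rewrite (eq_bigr (fun k : J => (fun b ij => w (b, ij) * cpart b (A ij.1 ij.2)) k.1 k.2));
  last by case.
rewrite -(pair_bigA _ (fun b ij => w (b, ij) * cpart b (A ij.1 ij.2))) big_bool /=.
rewrite -big_split /= -(pair_bigA _ (fun j l => w (true, (j, l)) * cpart true (A j l)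
  + w (false, (j, l)) * cpart false (A j l))) /=.
apply: eq_bigr => j _; rewrite cRe_sum; apply: eq_bigr => l _.
by rewrite cReM /w /cpart /=; ring.
Qed.

Let intw (k : J) : P.-integrable setT
  (fun psi : T => (w k)%:E * (cpart k.1 (projector (kof psi) k.2.1 k.2.2))%:E)%E.
Proof. exact/integrableZl/integrable_projector. Qed.

Let functional_sum : (EFin \o (fun psi : T => complex.Re (f (projector (kof psi))))) =
  (fun psi => \sum_(k : J) (w k)%:E * (cpart k.1 (projector (kof psi) k.2.1 k.2.2))%:E)%E.
Proof. by apply/funext => psi /=; rewrite Re_functionalE -sumEFin. Qed.

Lemma integrable_functional :
  P.-integrable setT (EFin \o (fun psi : T => complex.Re (f (projector (kof psi))))).
Proof. by rewrite functional_sum; apply: integrable_sum. Qed.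

(** The real part of [f] is a finite real combination of coordinates, each integrable along the
    projectors, so it commutes with the expectation. *)
Lemma expectation_functional :
  'E_P[fun psi => complex.Re (f (projector (kof psi)))]%E =
  (complex.Re (f (mean_state P)))%:E.
Proof.
rewrite expectationE -[X in integral _ _ X]/(EFin \o _) functional_sum.
rewrite integral_sum// Re_functionalE -sumEFin; apply: eq_bigr => k _.
have ip := integrable_projector k.1 k.2.1 k.2.2.
rewrite integralZl// cpart_mean_state EFinM expectationE fineK//.
exact: integrable_fin_num.
Qed.

End functional.

Variable S : {set 'I_m}.
Local Notation red psi := (reduced S (kof psi)).

Lemma measurable_reduced b a c :
  measurable_fun setT (fun psi : T => cpart b (red psi a c)).
Proof.
rewrite (_ : (fun _ => _) = (fun psi : T => \sum_x \sum_y
  (if [&& restr S (enum_val x) == enum_val a, restr S (enum_val y) == enum_val c &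
      restr (~: S) (enum_val x) == restr (~: S) (enum_val y)]
   then cpart b (projector (kof psi) x y) else 0))).
  apply: measurable_sum => x; apply: measurable_sum => y.
  by case: [&& _, _ & _]; [exact: measurable_projector|exact: measurable_cst].
apply/funext => psi; rewrite /reduced ptraceE.
case: b; rewrite /cpart ?cRe_sum ?cIm_sum; apply: eq_bigr => x _;
  rewrite ?cRe_sum ?cIm_sum; apply: eq_bigr => y _; by case: ifP.
Qed.

Lemma measurable_dist_to (M : sub_operator R d S) : M^t* = M ->
  measurable_fun setT (fun psi : T => trace_dist (red psi) M).
Proof.
move=> Mh; apply: measurable_trace_norm => [psi|a c|a c].
- by rewrite adjmxB reduced_hermitian Mh.
- under eq_fun do rewrite mxE cReD; apply: measurable_funD => //.
  exact: (measurable_reduced false).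
- under eq_fun do rewrite mxE cImD; apply: measurable_funD => //.
  exact: (measurable_reduced true).
Qed.

Lemma measurable_pair_dist :
  measurable_fun setT (fun z : T * T => trace_dist (red z.1) (red z.2)).
Proof.
have m1 b a c : measurable_fun setT (fun z : T * T => cpart b (red z.1 a c)).
  exact: (measurableT_comp (measurable_reduced b a c) measurable_fst).
have m2 b a c : measurable_fun setT (fun z : T * T => cpart b (red z.2 a c)).
  exact: (measurableT_comp (measurable_reduced b a c) measurable_snd).
apply: measurable_trace_norm => [z|a c|a c].
- by rewrite adjmxB !reduced_hermitian.
- apply: eq_measurable_fun (measurable_funB (m1 false a c) (m2 false a c)).
  by move=> z _; exact/esym/(cpartB false).
- apply: eq_measurable_fun (measurable_funB (m1 true a c) (m2 true a c)).
  by move=> z _; exact/esym/(cpartB true).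
Qed.

(** The unitary [W] optimal for the difference from the mean is fixed before averaging. For each ket
    it gives only a lower bound on the distance, and these lower bounds average exactly to the left
    side. *)
Lemma trace_dist_mean_le (A : sub_operator R d S) : A^t* = A ->
  ((trace_dist A (ptrace S (mean_state P)))%:E <=
   'E_P[fun psi => trace_dist A (red psi)])%E.
Proof.
move=> Ah; have Mh := ptrace_hermitian S mean_state_hermitian.
have /Re_tr_unitary_attained[W Wu Weq] :
    (A - ptrace S (mean_state P))^t* = A - ptrace S (mean_state P).
  by rewrite adjmxB Ah Mh.
rewrite /trace_dist Weq mulmxBr raddfB cReB.
pose f (B : operator R d) := \tr (W *m ptrace S B).
have fD : {morph f : B B' / B + B'}.
  by move=> B B'; rewrite /f ptraceD mulmxDr mxtraceD.
have fZ c B : f (c *: B) = c * f B by rewrite /f ptraceZ -scalemxAr mxtraceZ.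
have intf := integrable_functional fD fZ.
have intA : P.-integrable setT (EFin \o (fun _ : T => complex.Re (\tr (W *m A)))).
  exact: finite_measure_integrable_cst.
have -> : (complex.Re (\tr (W *m A)) - complex.Re (f (mean_state P)))%:E =
    'E_P[fun psi => (complex.Re (\tr (W *m A)) -
                     complex.Re (f (projector (kof psi))))%R]%E.
  rewrite expectationE; under eq_integral do rewrite EFinB.
  rewrite integralB_EFin// -[X in (_ - X)%E]expectationE expectation_functional//.
  by rewrite -[X in (X - _)%E]expectationE expectation_cst EFinB.
apply: expectation_le_of_le_integral.
- rewrite (_ : (fun _ => _) = (fun psi => trace_dist (red psi) A)).
    exact: measurable_dist_to.
  by apply/funext => psi; apply: trace_distC => //; exact: reduced_hermitian.
- by move=> psi; rewrite trace_norm_ge0// adjmxB Ah reduced_hermitian.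
- exact: (integrableB measurableT intA intf).
- move=> psi; rewrite /f -cReB -raddfB -mulmxBr.
  by apply: Re_tr_unitary_le => //; rewrite adjmxB Ah reduced_hermitian.
Qed.

End mean_state.

(** * Maxima over subsystems of a given size *)

Section max_over.
Context (R : realType) (m k : nat).
Local Open Scope ereal_scope.
Implicit Types F G : {set 'I_m} -> \bar R.

Lemma le_max_over F G : (forall S, F S <= G S) -> max_over k F <= max_over k G.
Proof.
move=> FG; apply: bigmax_le => [|S kS]; first exact: leNye.
by apply: le_trans (FG S) _; exact: le_bigmax_cond.
Qed.

Lemma le_max_over2 F G : (forall S, F S <= 2%:E * G S) ->
  max_over k F <= 2%:E * max_over k G.
Proof.
(* The default value [-oo] of the maximum lies below any bound; each remaining term is compared with
   its own [G S]. *)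
move=> FG; apply: bigmax_le => [|S kS]; first exact: leNye.
by apply: le_trans (FG S) _; rewrite lee_pmul2l// le_bigmax_cond.
Qed.

End max_over.

(** * The inequalities for a fixed subsystem *)

Section variations.
Local Open Scope ereal_scope.
Context (R : realType) (m : nat) (d : 'I_m -> nat) (C : set (ket R d)).
Context (S : {set 'I_m}).

(** Shared by both centres, the reduced mean state and the maximally mixed state: each of the two
    summands is at most the supremum of [e]. *)
Lemma VM_le_twice_central (e : ket R d -> R) :
  (forall psi psi', C psi -> C psi' ->
     (trace_dist (reduced S psi) (reduced S psi') <= e psi + e psi')%R) ->
  VM C S <= 2%:E * ereal_sup [set (e psi)%:E | psi in C].
Proof.
move=> De; apply: ge_ereal_sup => _ /= [psi Cpsi] [psi' Cpsi'] <-.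
rewrite mule_natl mule2n; apply: (@le_trans _ _ ((e psi)%:E + (e psi')%:E)).
  by rewrite -EFinD lee_fin De.
by apply: leeD; apply: ereal_sup_ubound; [exists psi|exists psi'].
Qed.

Lemma dist_le_VM psi psi' : C psi -> C psi' ->
  (trace_dist (reduced S psi) (reduced S psi'))%:E <= VM C S.
Proof. by move=> Cpsi Cpsi'; apply: ereal_sup_ubound; exists psi => //; exists psi'. Qed.

Lemma trace_dist_reduced_triangle (M : sub_operator R d S) psi psi' : M^t* = M ->
  (trace_dist (reduced S psi) (reduced S psi') <=
   trace_dist (reduced S psi) M + trace_dist (reduced S psi') M)%R.
Proof. by move=> Mh; apply: trace_dist_triangle => //; exact: reduced_hermitian. Qed.

Lemma VM_le_twice_tLambdaM : VM C S <= 2%:E * tLambdaM C S.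
Proof.
apply: (VM_le_twice_central
  (e := fun psi => trace_dist (reduced S psi) (maximally_mixed R d S))).
by move=> psi psi' _ _; apply/trace_dist_reduced_triangle/maximally_mixed_hermitian.
Qed.

Context (C_pure : forall psi, C psi -> unit_vector psi).
Context (C0 : C !=set0) (P : probability (ensembleType C0) R).
Local Notation T := (ensembleType C0).
Local Notation kof := (@ket_of R m d C C0).

Let mean_hermitian : (ptrace S (mean_state P))^t* = ptrace S (mean_state P).
Proof. exact/ptrace_hermitian/mean_state_hermitian. Qed.

Let dist_to_ge0 (M : sub_operator R d S) (psi : T) : M^t* = M ->
  (0 <= trace_dist (reduced S (kof psi)) M)%R.
Proof. by move=> Mh; rewrite trace_norm_ge0// adjmxB reduced_hermitian Mh. Qed.

Let pair_dist_ge0 (z : T * T) :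
  (0 <= trace_dist (reduced S (kof z.1)) (reduced S (kof z.2)))%R.
Proof. exact/dist_to_ge0/reduced_hermitian. Qed.

Lemma VM_le_twice_LambdaM : VM C S <= 2%:E * LambdaM P S.
Proof.
apply: (VM_le_twice_central
  (e := fun psi => trace_dist (reduced S psi) (ptrace S (mean_state P)))).
by move=> psi psi' _ _; exact: trace_dist_reduced_triangle.
Qed.

(** By Jensen the distance to the mean is at most an average of pairwise distances, each of which is
    below the supremum. *)
Lemma LambdaM_le_VM : LambdaM P S <= VM C S.
Proof.
apply: ge_ereal_sup => _ /= [psi Cpsi <-].
apply: le_trans (trace_dist_mean_le C_pure P (reduced_hermitian S psi)) _.
have distC (psi' : T) : trace_dist (reduced S psi) (reduced S (kof psi')) =
    trace_dist (reduced S (kof psi')) (reduced S psi).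
  by apply: trace_distC; exact: reduced_hermitian.
apply: expectation_le_cst => [|psi'|psi'].
- under eq_fun do rewrite distC.
  by apply: measurable_dist_to; exact: reduced_hermitian.
- by rewrite distC; exact/dist_to_ge0/reduced_hermitian.
- by apply: dist_le_VM => //; exact: ket_ofP.
Qed.

(** Jensen's inequality at each ket, averaged over that ket. *)
Lemma LambdaA_le_VA : LambdaA P S <= VA P S.
Proof.
apply: expectation_central_le_pair => //.
- exact: measurable_pair_dist.
- exact: measurable_dist_to.
- by move=> psi; exact: dist_to_ge0.
- by move=> psi; apply: trace_dist_mean_le => //; exact: reduced_hermitian.
Qed.

Let VA_le_twice_dist_to (M : sub_operator R d S) : M^t* = M ->
  VA P S <= 2%:E * 'E_P[fun psi => trace_dist (reduced S (kof psi)) M].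
Proof.
move=> Mh; apply: expectation_pair_le_central => //.
- exact: measurable_pair_dist.
- exact: measurable_dist_to.
- by move=> psi; exact: dist_to_ge0.
- by move=> psi psi'; exact: trace_dist_reduced_triangle.
Qed.

Lemma VA_le_twice_LambdaA : VA P S <= 2%:E * LambdaA P S.
Proof. exact: VA_le_twice_dist_to. Qed.

Lemma VA_le_twice_tLambdaA : VA P S <= 2%:E * tLambdaA P S.
Proof. exact/VA_le_twice_dist_to/maximally_mixed_hermitian. Qed.

Lemma LambdaA_le_LambdaM : LambdaA P S <= LambdaM P S.
Proof.
apply: expectation_le_cst => [|psi|psi].
- exact: measurable_dist_to.
- exact: dist_to_ge0.
- by apply: ereal_sup_ubound; exists (kof psi) => //; exact: ket_ofP.
Qed.

Lemma VA_le_VM : VA P S <= VM C S.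
Proof.
apply: expectation_le_cst => [|//|z].
- exact: measurable_pair_dist.
- by apply: dist_le_VM; exact: ket_ofP.
Qed.

End variations.

(** * All inequalities, for one subsystem and for the maxima *)

Local Open Scope ereal_scope.

Theorem proposition1 (R : realType) (m : nat) (hm : (2 <= m)%N)
    (d : 'I_m -> nat) (C : set (ket R d))
    (C_pure : forall psi, C psi -> unit_vector psi)
    (C0 : nonempty C) (P : probability (ensembleType C0) R)
    (k : nat) (hk : (0 < k <= m)%N)
    (S : {set 'I_m}) (hS : #|S| = k) :
  let VMk := max_over k (VM C) in
  let LambdaMk := max_over k (LambdaM P) in
  let tLambdaMk := max_over k (tLambdaM C) in
  let VAk := max_over k (VA P) in
  let LambdaAk := max_over k (LambdaA P) in
  let tLambdaAk := max_over k (tLambdaA P) in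
  ((LambdaM P S <= VM C S /\ VM C S <= 2%:E * LambdaM P S) /\
   (LambdaMk <= VMk /\ VMk <= 2%:E * LambdaMk) /\
   VM C S <= 2%:E * tLambdaM C S /\
   VMk <= 2%:E * tLambdaMk) /\
  ((LambdaA P S <= VA P S /\ VA P S <= 2%:E * LambdaA P S) /\
   (LambdaAk <= VAk /\ VAk <= 2%:E * LambdaAk) /\
   VA P S <= 2%:E * tLambdaA P S /\
   VAk <= 2%:E * tLambdaAk) /\
  (LambdaA P S <= LambdaM P S /\
   LambdaAk <= LambdaMk /\
   VA P S <= VM C S /\
   VAk <= VMk).
Proof.
move=> VMk LambdaMk tLambdaMk VAk LambdaAk tLambdaAk.
do !split.
- exact: LambdaM_le_VM.
- exact: VM_le_twice_LambdaM.
- by apply: le_max_over => S'; exact: LambdaM_le_VM.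
- by apply: le_max_over2 => S'; exact: VM_le_twice_LambdaM.
- exact: VM_le_twice_tLambdaM.
- by apply: le_max_over2 => S'; exact: VM_le_twice_tLambdaM.
- exact: LambdaA_le_VA.
- exact: VA_le_twice_LambdaA.
- by apply: le_max_over => S'; exact: LambdaA_le_VA.
- by apply: le_max_over2 => S'; exact: VA_le_twice_LambdaA.
- exact: VA_le_twice_tLambdaA.
- by apply: le_max_over2 => S'; exact: VA_le_twice_tLambdaA.
- exact: LambdaA_le_LambdaM.
- by apply: le_max_over => S'; exact: LambdaA_le_LambdaM.
- exact: VA_le_VM.
- by apply: le_max_over => S'; exact: VA_le_VM.
Qed.
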